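(* Let $P$ be a poset and $\Sigma$ a logical signature. For each Kripke model $\mathcal K$ on $P$ and $\Sigma$, there is a logically distributive category $\langle\mathbb K,N\rangle\in\Sigma\text{-Str}$ such that, for any logical formula $\phi$, $\mathcal K\vDash\phi$ if and only if $\phi$ is valid in $\mathbb K$.
   Context: **Syntax.** A logical signature $\Sigma=\langle S,F,R\rangle$ consists of sorts, function symbols $f\colon s_1\times\cdots\times s_n\to s_0$ and relation symbols $r\colon s_1\times\cdots\times s_n$; each sort $s$ has a denumerable set $V_s$ of variables. $\mathrm{LTerms}(\Sigma)$ is the set of sorted first-order terms $t:s$. Logical formulae are generated by $\top$, $\bot$, $r(t_1,\dots,t_n)$, $\wedge,\vee,\supset$, $\forall x{:}s.\,A$, $\exists x{:}s.\,A$; $\mathrm{FV}$ denotes free variables; substitution is capture-avoiding and formulae are taken up to renaming of bound variables. Formulae are identified with $\lambda$-types via $\bot=0$, $\top=1$, $\wedge=\times$, $\vee=+$, $\supset\,=\,\to$; $\lambda\mathrm{Types}(\Sigma)$ is the set of these. **Kripke models.** A Kripke model $\mathcal K$ on $P$ and $\Sigma$ consists of: for each $p\in P$ a classical first-order $\Sigma$-structure in sets, with nonempty sets $A_p^s$ ($s\in S$), functions $M_pf$ ($f\in F$) and relations $M_pr$ ($r\in R$); and for each $p\le q$ and $s\in S$ a function $A_{p,q}^s\colon A_p^s\to A_q^s$, such that $A_{p,p}^s=1$, $A_{p,r}^s=A_{q,r}^s\circ A_{p,q}^s$ for $p\le q\le r$, the maps $A_{p,q}$ commute with the interpretation of logical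 terms, and for each relation symbol $r$, terms $t_1,\dots,t_n$ of the appropriate sorts, and each assignment $\vec x$ at $p$ of their free variables, $(M_pt_1,\dots,M_pt_n)(\vec x)\in M_pr$ iff $(M_qt_1,\dots,M_qt_n)(A_{p,q}(\vec x))\in M_qr$. Given an assignment $v$ of elements at $p$ to the free variables (transported along $A_{p,q}$ when passing to $q\ge p$), validity at $p$ is defined by: $\top$ always, $\bot$ never; $r(t_1,\dots,t_n)$ iff $(M_pt_1,\dots,M_pt_n)(v)\in M_pr$; $\wedge$, $\vee$ componentwise; $\psi_1\supset\psi_2$ iff for every $q\ge p$, $\psi_1$ is not valid at $q$ or $\psi_2$ is valid at $q$; $\exists y{:}s.\,\psi$ iff there is $a\in A_p^s$ with $\psi$ valid at $p$ with $y$ interpreted as $a$; $\forall y{:}s.\,\psi$ iff for every $q\ge p$ and $a\in A_q^s$, $\psi$ is valid at $q$ with $y$ interpreted as $a$. $\mathcal K\vDash\phi$ means that $\phi$ is valid at every $p\in P$ under every assignment. **Logically distributive category.** A category $\mathbb K$ with a map $N\colon\lambda\mathrm{Types}(\Sigma)\to\mathrm{Obj}\,\mathbb K$ is logically distributive if: (1)–(3) $\mathbb K$ has finite products, finite co-products and exponentiation; (4) each $\Delta=[1_A\times\iota_1,1_A\times\iota_2]\colon(A\times B)+(A\times C)\to A\times(B+C)$ has an inverse. For a sort $s$, type $A$, $x\in V_s$, let $\Sigma_A(x{:}s)$ be the functor from the discrete category on $\{t:s\in\mathrm{LTerms}(\Sigma)\}$ to $\mathbb K$ with $t:s\mapsto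 N(A[t/x])$. Let $\mathbb K_{\forall x:s.A}$ be the subcategory of $\mathbb K$ whose objects are the vertexes of cones on $\Sigma_A(x{:}s)$ of the form $NB$ with $x:s\notin\mathrm{FV}(B)$ and whose arrows, apart from identities, are the arrows in the category of cones over $\Sigma_A(x{:}s)$ from these objects to $N(\forall x{:}s.\,A)$. Dually, $\mathbb K_{\exists x:s.A}$ has as objects the vertexes of co-cones on $\Sigma_A(x{:}s)$ of the form $NB$ with $x:s\notin\mathrm{FV}(B)$, and as arrows, apart from identities, the arrows in the category of co-cones from $N(\exists x{:}s.\,A)$ to these objects. (5) All $\mathbb K_{\forall x:s.A}$ have terminal objects and all $\mathbb K_{\exists x:s.A}$ have initial objects; (6) $N0=0$ (initial), $N1=1$ (terminal), $N(A\times B)=NA\times NB$, $N(A+B)=NA+NB$, $N(A\to B)=NB^{NA}$, $N(\forall x{:}s.\,A)$ is terminal in $\mathbb K_{\forall x:s.A}$, $N(\exists x{:}s.\,A)$ is initial in $\mathbb K_{\exists x:s.A}$; (7) if $x:s\notin\mathrm{FV}(A)$, the unique arrow $N(\exists x{:}s.\,A\times B)\to NA\times N(\exists x{:}s.\,B)$ in $\mathbb K_{\exists x:s.A\times B}$ has an inverse. $\Sigma\text{-Str}$ is the category whose objects are the logically distributive categories $\langle\mathbb D,M\rangle$ such that $\mathrm{Obj}\,\mathbb D\subseteq\lambda\mathrm{Types}(\Sigma)$ and $M$ is surjective. A formula $\phi$ is valid in $\langle\mathbb K,N\rangle$ when there exists an arrow $1\to N\phi$ in $\mathbb K$. *)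

(* Defs.v *)
From mathcomp Require Import all_boot all_order.
From mathcomp Require Import boolp classical_sets.

Set Implicit Arguments.
Unset Strict Implicit.
Unset Printing Implicit Defensive.
#[local] Obligation Tactic := idtac.

Record signature := Signature {
  sorts : Type;
  fsym : Type;
  farity : fsym -> nat;
  fdom : forall f : fsym, 'I_(farity f) -> sorts;
  fcod : fsym -> sorts;
  rsym : Type;
  rarity : rsym -> nat;
  rdom : forall r : rsym, 'I_(rarity r) -> sorts
}.

Definition vset (Sigma : signature) (s : sorts Sigma) : Type := nat.

(* Terms and formulae over an arbitrary sorted family [V] of variables.  The
   body of a quantifier over [s] lives over [ext V s], that is, [V] together
   with one new, nameless variable of sort [s]; hence Leibniz equality of
   formulae is equality up to renaming of bound variables, and substitution
   cannot capture.  The formulae with the named variables [vset] are the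
   lambda-types of the signature, and [All x A], [Ex x A] bind a named
   variable. *)
Inductive term (Sigma : signature) (V : sorts Sigma -> Type) :
    sorts Sigma -> Type :=
| TVar s of V s : term V s
| TApp (f : fsym Sigma) of (forall i, term V (fdom (f := f) i)) :
    term V (fcod f).
Arguments TVar {Sigma V s} _.
Arguments TApp {Sigma V} f _.

Inductive ext (Sigma : signature) (V : sorts Sigma -> Type) (s : sorts Sigma) :
    sorts Sigma -> Type :=
| New : ext V s s
| Old s' of V s' : ext V s s'.
Arguments New {Sigma V s}.
Arguments Old {Sigma V s s'} _.

Inductive form (Sigma : signature) (V : sorts Sigma -> Type) : Type :=
| Top
| Bot
| Rel (r : rsym Sigma) of (forall i, term V (rdom (r := r) i))
| And of form V & form V
| Or of form V & form V
| Imp of form V & form V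
| FAll (s : sorts Sigma) of form (ext V s)
| FEx (s : sorts Sigma) of form (ext V s).
Arguments Top {Sigma V}.
Arguments Bot {Sigma V}.
Arguments Rel {Sigma V} r _.

Definition lterm (Sigma : signature) : sorts Sigma -> Type :=
  term (@vset Sigma).
Definition ltype (Sigma : signature) : Type := form (@vset Sigma).

Fixpoint tbind (Sigma : signature) (V W : sorts Sigma -> Type)
    (sigma : forall s, V s -> term W s) s (t : term V s) : term W s :=
  match t with
  | TVar _ x => sigma _ x
  | TApp f ts => TApp f (fun i => tbind sigma (ts i))
  end.

Definition lift_bind (Sigma : signature) (V W : sorts Sigma -> Type)
    (sigma : forall s, V s -> term W s) (s s' : sorts Sigma)
    (y : ext V s s') : term (ext W s) s' :=
  match y with
  | New => TVar New
  | Old _ x => tbind (fun _ z => TVar (Old z)) (sigma _ x)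
  end.

Fixpoint fbind (Sigma : signature) (V W : sorts Sigma -> Type)
    (sigma : forall s, V s -> term W s) (A : form V) : form W :=
  match A with
  | Top => Top
  | Bot => Bot
  | Rel r ts => Rel r (fun i => tbind sigma (ts i))
  | And A B => And (fbind sigma A) (fbind sigma B)
  | Or A B => Or (fbind sigma A) (fbind sigma B)
  | Imp A B => Imp (fbind sigma A) (fbind sigma B)
  | FAll s A => FAll (fbind (lift_bind sigma (s := s)) A)
  | FEx s A => FEx (fbind (lift_bind sigma (s := s)) A)
  end.

Definition update (Sigma : signature) (T : sorts Sigma -> Type)
    (s : sorts Sigma) (x : vset s) (a : T s) (g : forall s', vset s' -> T s')
    (s' : sorts Sigma) (y : vset s') : T s' :=
  match pselect (s = s') with
  | left e =>
      if y == x :> nat then match e in _ = s0 return T s0 with erefl => a end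
      else g s' y
  | right _ => g s' y
  end.

Definition subst (Sigma : signature) (s : sorts Sigma) (x : vset s)
    (t : lterm s) (A : ltype Sigma) : ltype Sigma :=
  fbind (update x t (fun _ y => TVar y)) A.

Definition bind_var (Sigma : signature) (s : sorts Sigma) (x : vset s)
    (A : ltype Sigma) : form (ext (@vset Sigma) s) :=
  fbind (update x (TVar New) (fun _ y => TVar (Old y))) A.

Definition All (Sigma : signature) (s : sorts Sigma) (x : vset s)
  (A : ltype Sigma) : ltype Sigma := FAll (bind_var x A).
Definition Ex (Sigma : signature) (s : sorts Sigma) (x : vset s)
  (A : ltype Sigma) : ltype Sigma := FEx (bind_var x A).

Fixpoint TFV (Sigma : signature) (V : sorts Sigma -> Type) s (t : term V s) :
    set {s : sorts Sigma & V s} :=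
  match t with
  | TVar s x => [set existT _ s x]%classic
  | TApp f ts => (\bigcup_i TFV (ts i))%classic
  end.

Fixpoint FV (Sigma : signature) (V : sorts Sigma -> Type) (A : form V) :
    set {s : sorts Sigma & V s} :=
  match A with
  | Top | Bot => set0
  | Rel r ts => (\bigcup_i TFV (ts i))%classic
  | And A B | Or A B | Imp A B => (FV A `|` FV B)%classic
  | FAll s A | FEx s A =>
      [set y | FV A (existT _ (projT1 y) (Old (projT2 y)))]%classic
  end.

Definition fresh (Sigma : signature) (s : sorts Sigma) (x : vset s)
  (A : ltype Sigma) : Prop := ~ FV A (existT _ s x).

Lemma tbind_id (Sigma : signature) (V : sorts Sigma -> Type)
    (sigma : forall s, V s -> term V s) s (t : term V s) :
  (forall s' x, TFV t (existT _ s' x) -> sigma s' x = TVar x) ->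
  tbind sigma t = t.
Proof.
elim: t => [s' x|f ts IH] H /=; first exact: H.
by congr TApp; apply: functional_extensionality_dep => i; apply: IH => s' x Hx;
  apply: H; exists i.
Qed.

Lemma fbind_id (Sigma : signature) (V : sorts Sigma -> Type)
    (sigma : forall s, V s -> term V s) (A : form V) :
  (forall s x, FV A (existT _ s x) -> sigma s x = TVar x) ->
  fbind sigma A = A.
Proof.
elim: A sigma => {V} //=
  [V r ts|V A IA B IB|V A IA B IB|V A IA B IB|V s A IA|V s A IA] sigma H.
- congr Rel; apply: functional_extensionality_dep => i.
  by apply: tbind_id => s x Hx; apply: H; exists i.
- by rewrite IA ?IB // => s x Hx; apply: H; [right|left].
- by rewrite IA ?IB // => s x Hx; apply: H; [right|left].
- by rewrite IA ?IB // => s x Hx; apply: H; [right|left].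
- by rewrite IA // => s' [//|s0 x] Hx /=; rewrite H.
- by rewrite IA // => s' [//|s0 x] Hx /=; rewrite H.
Qed.

Lemma subst_fresh (Sigma : signature) (s : sorts Sigma) (x : vset s)
    (t : lterm s) (A : ltype Sigma) : fresh x A -> subst x t A = A.
Proof.
move=> xA; apply: fbind_id => s' y yA; rewrite /update.
case: pselect => // e; case: eqP => // yx.
by case: xA; move: y yA yx; case: _ / e => y yA <-.
Qed.

Lemma TFV_tbind (Sigma : signature) (V W : sorts Sigma -> Type)
    (sigma : forall s, V s -> term W s) s (t : term V s) y :
  TFV (tbind sigma t) y ->
  exists z, TFV t z /\ TFV (sigma (projT1 z) (projT2 z)) y.
Proof.
elim: t => [s' x|f ts IH] /= H; first by exists (existT _ s' x).
by have [i _ /IH [z [zi zy]]] := H; exists z; split => //; exists i.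
Qed.

Lemma TFV_lift (Sigma : signature) (V W : sorts Sigma -> Type)
    (sigma : forall s, V s -> term W s) s s' (y : ext V s s') s0 (w : W s0) :
  TFV (lift_bind sigma y) (existT _ s0 (Old w)) ->
  exists z, existT _ s' y = existT _ (projT1 z) (Old (projT2 z)) /\
    TFV (sigma (projT1 z) (projT2 z)) (existT _ s0 w).
Proof.
pose old (z : {s' : sorts Sigma & ext W s s'}) :=
  if z is existT _ (Old s1 x) then Some (existT W s1 x) else None.
case: y => [/= /(congr1 old)//|{}s' x /= /TFV_tbind [[s1 z] [xz /=]]].
by move=> /(congr1 old) /Some_inj E; exists (existT _ s' x); rewrite E.
Qed.

Lemma FV_fbind (Sigma : signature) (V W : sorts Sigma -> Type)
    (sigma : forall s, V s -> term W s) (A : form V) y :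
  FV (fbind sigma A) y ->
  exists z, FV A z /\ TFV (sigma (projT1 z) (projT2 z)) y.
Proof.
elim: A W sigma y => {V} //=
  [V r ts|V A IA B IB|V A IA B IB|V A IA B IB|V s A IA|V s A IA] W sigma y.
- by move=> [i _ /TFV_tbind [z [zi zy]]]; exists z; split => //; exists i.
- by move=> [/IA|/IB] [z [zA zy]]; exists z; split => //; [left|right].
- by move=> [/IA|/IB] [z [zA zy]]; exists z; split => //; [left|right].
- by move=> [/IA|/IB] [z [zA zy]]; exists z; split => //; [left|right].
- case: y => s0 w /= /IA [[s' u] /= [uA ul]].
  have [z [zE zw]] := @TFV_lift _ _ _ _ _ _ _ _ _ ul.
  by exists z; rewrite -zE.
- case: y => s0 w /= /IA [[s' u] /= [uA ul]].
  have [z [zE zw]] := @TFV_lift _ _ _ _ _ _ _ _ _ ul.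
  by exists z; rewrite -zE.
Qed.

Lemma fresh_bind_var (Sigma : signature) (s : sorts Sigma) (x : vset s)
    (A : ltype Sigma) : ~ FV (bind_var x A) (existT _ s (Old x)).
Proof.
pose old (z : {s' : sorts Sigma & ext (@vset Sigma) s s'}) :=
  if z is existT _ (Old s1 x) then Some (existT (@vset Sigma) s1 x) else None.
move=> /FV_fbind [[s' y] [_ /=]]; rewrite /update.
case: pselect => [e|ne].
  case: eqP => [_|yx]; first by case: _ / e => /(congr1 old).
  by move=> /(congr1 old) /Some_inj /(congr1 (fun z => projT2 z : nat)) /esym.
by move=> /(congr1 old) /Some_inj /(congr1 (@projT1 _ _)) e; apply: ne.
Qed.

Lemma fresh_All (Sigma : signature) (s : sorts Sigma) (x : vset s)
  (A : ltype Sigma) : fresh x (All x A).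
Proof. exact: fresh_bind_var. Qed.

Lemma fresh_Ex (Sigma : signature) (s : sorts Sigma) (x : vset s)
  (A : ltype Sigma) : fresh x (Ex x A).
Proof. exact: fresh_bind_var. Qed.

Record structure (Sigma : signature) := Structure {
  carrier :> sorts Sigma -> Type;
  carrier_inhabited : forall s, inhabited (carrier s);
  fun_int : forall f : fsym Sigma,
    (forall i, carrier (fdom (f := f) i)) -> carrier (fcod f);
  rel_int : forall r : rsym Sigma,
    (forall i, carrier (rdom (r := r) i)) -> Prop
}.
Arguments fun_int {Sigma} _ f _.
Arguments rel_int {Sigma} _ r _.

(* Since carriers are nonempty, assignments may be taken total. *)
Definition assignment (Sigma : signature) (V : sorts Sigma -> Type)
  (M : sorts Sigma -> Type) := forall s, V s -> M s.

Fixpoint teval (Sigma : signature) (M : structure Sigma)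
    (V : sorts Sigma -> Type) (v : assignment V M) s (t : term V s) : M s :=
  match t with
  | TVar _ x => v _ x
  | TApp f ts => fun_int M f (fun i => teval v (ts i))
  end.

Record kripke_model (disp : Order.disp_t) (P : porderType disp)
    (Sigma : signature) := KripkeModel {
  kstr :> P -> structure Sigma;
  ktrans : forall p q : P, (p <= q)%O -> forall s, kstr p s -> kstr q s;
  ktrans_id : forall (p : P) (pp : (p <= p)%O) s (a : kstr p s),
    ktrans pp a = a;
  ktrans_comp : forall (p q r : P) (pq : (p <= q)%O) (qr : (q <= r)%O)
      (pr : (p <= r)%O) s (a : kstr p s),
    ktrans pr a = ktrans qr (ktrans pq a);
  ktrans_term : forall (p q : P) (pq : (p <= q)%O)
      (v : assignment (@vset Sigma) (kstr p)) s (t : lterm s),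
    ktrans pq (teval v t) = teval (fun _ x => ktrans pq (v _ x)) t;
  ktrans_rel : forall (p q : P) (pq : (p <= q)%O)
      (v : assignment (@vset Sigma) (kstr p)) (r : rsym Sigma)
      (ts : forall i, lterm (rdom (r := r) i)),
    rel_int (kstr p) r (fun i => teval v (ts i)) <->
    rel_int (kstr q) r (fun i => teval (fun _ x => ktrans pq (v _ x)) (ts i))
}.

Definition extend (Sigma : signature) (V M : sorts Sigma -> Type)
    (v : assignment V M) (s : sorts Sigma) (a : M s) :
    assignment (ext V s) M :=
  fun s' y =>
    match y in ext _ _ s0 return M s0 with
    | New => a
    | Old _ x => v _ x
    end.

Fixpoint valid_at (disp : Order.disp_t) (P : porderType disp)
    (Sigma : signature) (K : kripke_model P Sigma) (V : sorts Sigma -> Type)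
    (A : form V) (p : P) (v : assignment V (K p)) : Prop :=
  match A in form _ return assignment _ (K p) -> Prop with
  | Top => fun _ => True
  | Bot => fun _ => False
  | Rel r ts => fun v => rel_int (K p) r (fun i => teval v (ts i))
  | And A B => fun v => valid_at A v /\ valid_at B v
  | Or A B => fun v => valid_at A v \/ valid_at B v
  | Imp A B => fun v => forall (q : P) (pq : (p <= q)%O),
      ~ valid_at A (fun _ x => ktrans pq (v _ x)) \/
      valid_at B (fun _ x => ktrans pq (v _ x))
  | FAll s A => fun v => forall (q : P) (pq : (p <= q)%O) (a : K q s),
      valid_at A (extend (fun _ x => ktrans pq (v _ x)) a)
  | FEx s A => fun v => exists a : K p s, valid_at A (extend v a)
  end v.

Definition kripke_valid (disp : Order.disp_t) (P : porderType disp)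
    (Sigma : signature) (K : kripke_model P Sigma) (A : ltype Sigma) : Prop :=
  forall (p : P) (v : assignment (@vset Sigma) (K p)), valid_at A v.

Record category (ob : Type) := Category {
  hom : ob -> ob -> Type;
  idm : forall X, hom X X;
  compm : forall X Y Z, hom Y Z -> hom X Y -> hom X Z;
  comp1m : forall X Y (f : hom X Y), compm (idm Y) f = f;
  compm1 : forall X Y (f : hom X Y), compm f (idm X) = f;
  compmA : forall X Y Z W (h : hom Z W) (g : hom Y Z) (f : hom X Y),
    compm h (compm g f) = compm (compm h g) f
}.
Arguments hom {ob} _ _ _.
Arguments idm {ob} _ _.
Arguments compm {ob _ X Y Z} _ _.

Definition terminal (ob : Type) (C : category ob) (T : ob) : Prop :=
  forall X, exists f : hom C X T, forall g, g = f.

Definition initial (ob : Type) (C : category ob) (I : ob) : Prop :=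
  forall X, exists f : hom C I X, forall g, g = f.

Definition has_inverse (ob : Type) (C : category ob) (X Y : ob)
    (f : hom C X Y) : Prop :=
  exists g : hom C Y X, compm g f = idm C X /\ compm f g = idm C Y.

Definition eq_hom (ob : Type) (C : category ob) (X Y : ob) (e : X = Y) :
    hom C X Y :=
  match e in _ = Z return hom C X Z with erefl => idm C X end.

Inductive is_identity (ob : Type) (C : category ob) :
    forall X Y : ob, hom C X Y -> Prop :=
| IsIdentity X : is_identity (idm C X).

Lemma comp_is_identity_l (ob : Type) (C : category ob) (X Y Z : ob)
    (g : hom C Y Z) (Q : forall X Y, hom C X Y -> Prop) :
  is_identity g -> forall f : hom C X Y, Q _ _ f -> Q _ _ (compm g f).
Proof. by move=> [W] f; rewrite comp1m. Qed.

Lemma comp_is_identity_r (ob : Type) (C : category ob) (X Y Z : ob)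
    (f : hom C X Y) (Q : forall X Y, hom C X Y -> Prop) :
  is_identity f -> forall g : hom C Y Z, Q _ _ g -> Q _ _ (compm g f).
Proof. by move=> [W] g; rewrite compm1. Qed.

Lemma sig_eq (T : Type) (Q : T -> Prop) (u v : {x | Q x}) :
  proj1_sig u = proj1_sig v -> u = v.
Proof. by case: u v => [x Qx] [y Qy] /= xy; apply: eq_exist. Qed.

Program Definition subcategory_into (ob : Type) (C : category ob)
    (O R : ob -> Prop) : category {X : ob | O X} :=
  @Category {X : ob | O X}
    (fun X Y => {f : hom C (proj1_sig X) (proj1_sig Y) |
       is_identity f \/ R (proj1_sig Y)})
    (fun X => exist _ (idm C (proj1_sig X)) (or_introl (IsIdentity C _)))
    (fun X Y Z g f => exist _ (compm (proj1_sig g) (proj1_sig f)) _) _ _ _.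
Next Obligation.
move=> ob C O R [X OX] [Y OY] [Z OZ] [g hg] [f hf] /=.
case: hg => [hg|RZ]; last by right.
exact: (comp_is_identity_l (Q := fun _ Y h => is_identity h \/ R Y) hg).
Qed.
Next Obligation. by move=> *; apply: sig_eq; rewrite /= comp1m. Qed.
Next Obligation. by move=> *; apply: sig_eq; rewrite /= compm1. Qed.
Next Obligation. by move=> *; apply: sig_eq; rewrite /= compmA. Qed.

Program Definition subcategory_from (ob : Type) (C : category ob)
    (O R : ob -> Prop) : category {X : ob | O X} :=
  @Category {X : ob | O X}
    (fun X Y => {f : hom C (proj1_sig X) (proj1_sig Y) |
       is_identity f \/ R (proj1_sig X)})
    (fun X => exist _ (idm C (proj1_sig X)) (or_introl (IsIdentity C _)))
    (fun X Y Z g f => exist _ (compm (proj1_sig g) (proj1_sig f)) _) _ _ _.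
Next Obligation.
move=> ob C O R [X OX] [Y OY] [Z OZ] [g hg] [f hf] /=.
case: hf => [hf|RX]; last by right.
exact: (comp_is_identity_r (Q := fun X _ h => is_identity h \/ R X) hf).
Qed.
Next Obligation. by move=> *; apply: sig_eq; rewrite /= comp1m. Qed.
Next Obligation. by move=> *; apply: sig_eq; rewrite /= compm1. Qed.
Next Obligation. by move=> *; apply: sig_eq; rewrite /= compmA. Qed.

(* A functor from a discrete category is a family of objects, and the
   naturality of a (co-)cone on it is void. *)
Record cone (ob : Type) (C : category ob) (I : Type) (D : I -> ob) := Cone {
  cone_vertex : ob;
  cone_leg : forall i, hom C cone_vertex (D i)
}.

Record cocone (ob : Type) (C : category ob) (I : Type) (D : I -> ob) :=
Cocone {
  cocone_vertex : ob;
  cocone_leg : forall i, hom C (D i) cocone_vertex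
}.

Program Definition cone_category (ob : Type) (C : category ob) (I : Type)
    (D : I -> ob) : category (cone C D) :=
  @Category (cone C D)
    (fun c d => {f : hom C (cone_vertex c) (cone_vertex d) |
       forall i, compm (cone_leg d i) f = cone_leg c i})
    (fun c => idm C (cone_vertex c))
    (fun c d e g f => exist _ (compm (proj1_sig g) (proj1_sig f)) _) _ _ _.
Next Obligation. by move=> ob C I D c i; rewrite compm1. Qed.
Next Obligation.
by move=> ob C I D c d e [g hg] [f hf] i /=; rewrite compmA hg hf.
Qed.
Next Obligation. by move=> *; apply: sig_eq; rewrite /= comp1m. Qed.
Next Obligation. by move=> *; apply: sig_eq; rewrite /= compm1. Qed.
Next Obligation. by move=> *; apply: sig_eq; rewrite /= compmA. Qed.

Program Definition cocone_category (ob : Type) (C : category ob) (I : Type)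
    (D : I -> ob) : category (cocone C D) :=
  @Category (cocone C D)
    (fun c d => {f : hom C (cocone_vertex c) (cocone_vertex d) |
       forall i, compm f (cocone_leg c i) = cocone_leg d i})
    (fun c => idm C (cocone_vertex c))
    (fun c d e g f => exist _ (compm (proj1_sig g) (proj1_sig f)) _) _ _ _.
Next Obligation. by move=> ob C I D c i; rewrite comp1m. Qed.
Next Obligation.
by move=> ob C I D c d e [g hg] [f hf] i /=; rewrite -compmA hf hg.
Qed.
Next Obligation. by move=> *; apply: sig_eq; rewrite /= comp1m. Qed.
Next Obligation. by move=> *; apply: sig_eq; rewrite /= compm1. Qed.
Next Obligation. by move=> *; apply: sig_eq; rewrite /= compmA. Qed.

(* The structure is chosen because [N] must preserve it up to equality. *)
Record bicartesian_closed (ob : Type) (C : category ob) := BicartesianClosed {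
  ob1 : ob;
  ob1_terminal : terminal C ob1;
  obprod : ob -> ob -> ob;
  pi1 : forall A B, hom C (obprod A B) A;
  pi2 : forall A B, hom C (obprod A B) B;
  pairing : forall X A B, hom C X A -> hom C X B -> hom C X (obprod A B);
  pi1_pairing : forall X A B (f : hom C X A) (g : hom C X B),
    compm (pi1 A B) (pairing f g) = f;
  pi2_pairing : forall X A B (f : hom C X A) (g : hom C X B),
    compm (pi2 A B) (pairing f g) = g;
  pairing_unique : forall X A B (h : hom C X (obprod A B)),
    h = pairing (compm (pi1 A B) h) (compm (pi2 A B) h);
  ob0 : ob;
  ob0_initial : initial C ob0;
  obsum : ob -> ob -> ob;
  inj1 : forall A B, hom C A (obsum A B);
  inj2 : forall A B, hom C B (obsum A B);
  copair : forall A B X, hom C A X -> hom C B X -> hom C (obsum A B) X;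
  copair_inj1 : forall A B X (f : hom C A X) (g : hom C B X),
    compm (copair f g) (inj1 A B) = f;
  copair_inj2 : forall A B X (f : hom C A X) (g : hom C B X),
    compm (copair f g) (inj2 A B) = g;
  copair_unique : forall A B X (h : hom C (obsum A B) X),
    h = copair (compm h (inj1 A B)) (compm h (inj2 A B));
  obexp : ob -> ob -> ob; (* [obexp B A] is B^A *)
  ev : forall A B, hom C (obprod (obexp B A) A) B;
  curry : forall X A B, hom C (obprod X A) B -> hom C X (obexp B A);
  ev_curry : forall X A B (f : hom C (obprod X A) B),
    compm (ev A B)
      (pairing (compm (curry f) (pi1 X A)) (pi2 X A)) = f;
  curry_unique : forall X A B (h : hom C X (obexp B A)),
    h = curry (compm (ev A B) (pairing (compm h (pi1 X A)) (pi2 X A)))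
}.
Arguments pi1 {ob C} _ A B.
Arguments pi2 {ob C} _ A B.
Arguments pairing {ob C} _ {X A B} _ _.
Arguments inj1 {ob C} _ A B.
Arguments inj2 {ob C} _ A B.
Arguments copair {ob C} _ {A B X} _ _.

Definition idm_times (ob : Type) (C : category ob)
    (S : bicartesian_closed C) (A B B' : ob) (f : hom C B B') :
    hom C (obprod S A B) (obprod S A B') :=
  pairing S (compm (idm C A) (pi1 S A B)) (compm f (pi2 S A B)).

Definition Delta (ob : Type) (C : category ob) (S : bicartesian_closed C)
    (A B D : ob) :
    hom C (obsum S (obprod S A B) (obprod S A D)) (obprod S A (obsum S B D)) :=
  copair S (idm_times S A (inj1 S B D)) (idm_times S A (inj2 S B D)).

Definition subst_diagram (Sigma : signature) (ob : Type)
    (N : ltype Sigma -> ob) (s : sorts Sigma) (x : vset s) (A : ltype Sigma) :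
    lterm s -> ob :=
  fun t => N (subst x t A).

(* An arrow of (co-)cones is only meaningful once the legs of both ends are
   given, so the objects of [K_All] and [K_Ex] are the admissible vertexes
   taken together with their (co-)cones. *)
Definition K_All_ob (Sigma : signature) (ob : Type) (K : category ob)
    (N : ltype Sigma -> ob) (s : sorts Sigma) (x : vset s) (A : ltype Sigma)
    (c : cone K (subst_diagram N x A)) : Prop :=
  exists B : ltype Sigma, fresh x B /\ cone_vertex c = N B.

Definition K_All (Sigma : signature) (ob : Type) (K : category ob)
    (N : ltype Sigma -> ob) (s : sorts Sigma) (x : vset s) (A : ltype Sigma) :
    category {c : cone K (subst_diagram N x A) | K_All_ob c} :=
  subcategory_into (cone_category K (subst_diagram N x A))
    (@K_All_ob Sigma ob K N s x A)
    (fun c => cone_vertex c = N (All x A)).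

Definition K_Ex_ob (Sigma : signature) (ob : Type) (K : category ob)
    (N : ltype Sigma -> ob) (s : sorts Sigma) (x : vset s) (A : ltype Sigma)
    (c : cocone K (subst_diagram N x A)) : Prop :=
  exists B : ltype Sigma, fresh x B /\ cocone_vertex c = N B.

Definition K_Ex (Sigma : signature) (ob : Type) (K : category ob)
    (N : ltype Sigma -> ob) (s : sorts Sigma) (x : vset s) (A : ltype Sigma) :
    category {c : cocone K (subst_diagram N x A) | K_Ex_ob c} :=
  subcategory_from (cocone_category K (subst_diagram N x A))
    (@K_Ex_ob Sigma ob K N s x A)
    (fun c => cocone_vertex c = N (Ex x A)).

(* [1_NA * i_t] on the co-cone [NB[t/x] -> vertex J], as a co-cone for
   [A * B]; [(A * B)[t/x]] is [A * B[t/x]] because [x] is not free in [A]. *)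
Lemma N_subst_And (Sigma : signature) (ob : Type) (K : category ob)
    (S : bicartesian_closed K) (N : ltype Sigma -> ob)
    (N_And : forall A B, N (And A B) = obprod S (N A) (N B))
    (s : sorts Sigma) (x : vset s) (A B : ltype Sigma) (xA : fresh x A)
    (t : lterm s) :
  N (subst x t (And A B)) = obprod S (N A) (N (subst x t B)).
Proof. by rewrite -N_And -{2}(subst_fresh t xA). Qed.

Definition times_cocone (Sigma : signature) (ob : Type) (K : category ob)
    (S : bicartesian_closed K) (N : ltype Sigma -> ob)
    (N_And : forall A B, N (And A B) = obprod S (N A) (N B))
    (s : sorts Sigma) (x : vset s) (A B : ltype Sigma) (xA : fresh x A)
    (J : cocone K (subst_diagram N x B)) :
    cocone K (subst_diagram N x (And A B)) :=
  @Cocone ob K (lterm s) (subst_diagram N x (And A B))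
    (obprod S (N A) (cocone_vertex J))
    (fun t => compm (idm_times S (N A) (cocone_leg J t))
                   (eq_hom K (N_subst_And N_And B xA t))).

Lemma times_cocone_ob (Sigma : signature) (ob : Type) (K : category ob)
    (S : bicartesian_closed K) (N : ltype Sigma -> ob)
    (N_And : forall A B, N (And A B) = obprod S (N A) (N B))
    (s : sorts Sigma) (x : vset s) (A B : ltype Sigma) (xA : fresh x A)
    (J : cocone K (subst_diagram N x B)) :
  cocone_vertex J = N (Ex x B) -> K_Ex_ob (times_cocone N_And xA J).
Proof.
move=> JE; exists (And A (Ex x B)); split; last by rewrite N_And /= JE.
by case => [/xA|/fresh_Ex].
Qed.

Record logically_distributive (Sigma : signature) (ob : Type)
    (K : category ob) (N : ltype Sigma -> ob) := LogicallyDistributive {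
  ld_bcc :> bicartesian_closed K;
  ld_Delta : forall A B D : ob, has_inverse (Delta ld_bcc A B D);
  ld_All : forall s (x : vset s) A, exists T, terminal (K_All K N x A) T;
  ld_Ex : forall s (x : vset s) A, exists I, initial (K_Ex K N x A) I;
  ld_N_Bot : N Bot = ob0 ld_bcc;
  ld_N_Top : N Top = ob1 ld_bcc;
  ld_N_And : forall A B, N (And A B) = obprod ld_bcc (N A) (N B);
  ld_N_Or : forall A B, N (Or A B) = obsum ld_bcc (N A) (N B);
  ld_N_Imp : forall A B, N (Imp A B) = obexp ld_bcc (N B) (N A);
  ld_N_All : forall s (x : vset s) A, exists T,
    cone_vertex (proj1_sig T) = N (All x A) /\ terminal (K_All K N x A) T;
  ld_N_Ex : forall s (x : vset s) A, exists I,
    cocone_vertex (proj1_sig I) = N (Ex x A) /\ initial (K_Ex K N x A) I;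
  (* [I] and [J] are the objects N(Ex x:s. A * B) and N(Ex x:s. B). *)
  ld_frobenius : forall s (x : vset s) A B (xA : fresh x A)
    (I : {c : cocone K (subst_diagram N x (And A B)) | K_Ex_ob c})
    (J : {c : cocone K (subst_diagram N x B) | K_Ex_ob c})
    (IE : cocone_vertex (proj1_sig I) = N (Ex x (And A B)))
    (JE : cocone_vertex (proj1_sig J) = N (Ex x B)),
    initial (K_Ex K N x (And A B)) I -> initial (K_Ex K N x B) J ->
    forall f : hom (K_Ex K N x (And A B)) I
                 (exist _ _ (times_cocone_ob ld_N_And xA JE)),
      has_inverse (proj1_sig (proj1_sig f))
}.

Record sigma_str (Sigma : signature) := SigmaStr {
  str_ob : set (ltype Sigma);
  str_cat : category {A : ltype Sigma | str_ob A};
  str_N : ltype Sigma -> {A : ltype Sigma | str_ob A};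
  str_ld :> logically_distributive str_cat str_N;
  str_surj : forall X, exists A, str_N A = X
}.

Definition str_valid (Sigma : signature) (D : sigma_str Sigma)
    (phi : ltype Sigma) : Prop :=
  inhabited (hom (str_cat D) (ob1 D) (str_N D phi)).

(* Main.v *)
Require Import Defs.
From mathcomp Require Import all_boot all_order.
From mathcomp Require Import boolp classical_sets.

(** The category is the preorder of semantic entailment: its objects are all
the formulae, [N] is the identity, and there is at most one arrow from [A] to
[B], present when [B] holds wherever [A] does, at every node and under every
assignment.  A formula is then valid in the category exactly when [Top]
entails it, that is, when the Kripke model validates it.

All equations between arrows hold for free in a preorder, so being logically
distributive amounts to the laws of entailment.  Those for [Imp] need validity
to persist along the order of nodes ([valid_persist]), which rests on the
transition maps being homomorphisms that preserve and reflect the relations.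

The quantifiers are the delicate point: a cone on the instances of [A] only
sees elements denoted by terms, whereas [All x A] speaks of all elements.  But
variables are terms, and [A] is the instance of [A] at the term [x].  So when
[B] entails all instances of [A], it entails [A] itself, under every
assignment; if [x] is not free in [B], the value of [x] can be varied without
disturbing [B] ([valid_update_fresh]), and hence [B] entails [All x A].  The
dual argument makes [Ex x A] an initial co-cone, and the Frobenius law is the
usual distribution of conjunction over existential quantification. *)

Set Implicit Arguments.
Unset Strict Implicit.
Unset Printing Implicit Defensive.

(** * Assignments and the evaluation of terms *)

Section Update.
Context (Sigma : signature) (T : sorts Sigma -> Type).

Lemma update_map (U : sorts Sigma -> Type) (h : forall s, T s -> U s)
    s (x : vset s) (a : T s) (g : assignment (@vset Sigma) T) s' (y : vset s') :
  h s' (update x a g y) = update x (h s a) (fun _ z => h _ (g _ z)) y.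
Proof.
rewrite /update; case: pselect => // e; case: ifP => // _.
by case: _ / e.
Qed.

Lemma update_id s (x : vset s) (g : assignment (@vset Sigma) T) s'
    (y : vset s') : update x (g s x) g y = g s' y.
Proof.
rewrite /update; case: pselect => // e; case: eqP => // yx.
by move: y yx; case: _ / e => y ->.
Qed.

Lemma update_neq s (x : vset s) (a : T s) (g : assignment (@vset Sigma) T) s'
    (y : vset s') :
  existT (@vset Sigma) s' y <> existT _ s x -> update x a g y = g s' y.
Proof.
rewrite /update => ne; case: pselect => // e; case: eqP => // yx.
by case: ne; move: y yx; case: _ / e => y ->.
Qed.

End Update.

Lemma assignment_eq (Sigma : signature) (V M : sorts Sigma -> Type)
    (v w : assignment V M) : (forall s x, v s x = w s x) -> v = w.
Proof.
move=> vw; apply: functional_extensionality_dep => s.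
by apply: functional_extensionality_dep => x.
Qed.

Lemma teval_tbind (Sigma : signature) (M : structure Sigma)
    (V W : sorts Sigma -> Type) (sigma : forall s, V s -> term W s)
    (v : assignment W M) s (t : term V s) :
  teval v (tbind sigma t) = teval (fun _ x => teval v (sigma _ x)) t.
Proof.
elim: t => [//|f ts IH] /=; congr fun_int.
by apply: functional_extensionality_dep.
Qed.

Lemma teval_FV (Sigma : signature) (M : structure Sigma)
    (V : sorts Sigma -> Type) (v w : assignment V M) s (t : term V s) :
  (forall s' x, TFV t (existT _ s' x) -> v s' x = w s' x) ->
  teval v t = teval w t.
Proof.
elim: t => [s' x|f ts IH] vw /=; first exact: vw.
congr fun_int; apply: functional_extensionality_dep => i.
by apply: IH => s' x xi; apply: vw; exists i.
Qed.

(** Any tuple of arguments is the value of a tuple of distinct variables; this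
turns properties of the transition maps that are given for evaluated terms into
properties for arbitrary elements. *)
Lemma tuple_assignment (Sigma : signature) (M : structure Sigma) n
    (d : 'I_n -> sorts Sigma) (b : forall i, M (d i)) :
  exists v : assignment (@vset Sigma) M, forall i, v (d i) (i : nat) = b i.
Proof.
have dflt s : {a : M s | True}.
  by apply: cid; case: (carrier_inhabited M s) => a; exists a.
exists (fun s y =>
  if insub y is Some i then
    match pselect (d i = s) with
    | left e => match e in _ = s0 return M s0 with erefl => b i end
    | right _ => sval (dflt s)
    end
  else sval (dflt s)) => i.
rewrite valK; case: pselect => // e.
by rewrite (Prop_irrelevance e erefl).
Qed.

(** * Semantics of formulae in a Kripke model *)

Section Kripke.
Context (disp : Order.disp_t) (P : porderType disp) (Sigma : signature).
Context (K : kripke_model P Sigma).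
Implicit Types (p q r : P) (V W : sorts Sigma -> Type).

Lemma ktrans_fun_int p q (pq : (p <= q)%O) (f : Defs.fsym Sigma)
    (b : forall i, K p (fdom (f := f) i)) :
  ktrans pq (fun_int (K p) f b) = fun_int (K q) f (fun i => ktrans pq (b i)).
Proof.
have [v vb] := tuple_assignment b.
have /= := ktrans_term pq v (TApp f (fun i => TVar (i : nat))).
have -> : (fun i => v (fdom (f := f) i) (i : nat)) = b.
  exact: functional_extensionality_dep.
by move=> ->; congr fun_int; apply: functional_extensionality_dep => i;
  rewrite vb.
Qed.

Lemma ktrans_rel_int p q (pq : (p <= q)%O) (r : rsym Sigma)
    (b : forall i, K p (rdom (r := r) i)) :
  rel_int (K p) r b <-> rel_int (K q) r (fun i => ktrans pq (b i)).
Proof.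
have [v vb] := tuple_assignment b.
have /= := @ktrans_rel _ _ _ K p q pq v r (fun i => TVar (i : nat)).
have -> : (fun i => v (rdom (r := r) i) (i : nat)) = b.
  exact: functional_extensionality_dep.
suff -> : (fun i => ktrans pq (v (rdom (r := r) i) (i : nat))) =
          (fun i => ktrans pq (b i)) by [].
by apply: functional_extensionality_dep => i; rewrite vb.
Qed.

(** This folds the expression that [valid_at] uses at later nodes, so that the
functoriality of the transition maps can be rewritten with. *)
Definition transport V p q (pq : (p <= q)%O) (v : assignment V (K p)) :
    assignment V (K q) :=
  fun _ x => ktrans pq (v _ x).

Lemma transport_id V p (pp : (p <= p)%O) (v : assignment V (K p)) :
  transport pp v = v.
Proof. by apply: assignment_eq => s x; exact: ktrans_id. Qed.

Lemma transport_comp V p q r (pq : (p <= q)%O) (qr : (q <= r)%O)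
    (pr : (p <= r)%O) (v : assignment V (K p)) :
  transport qr (transport pq v) = transport pr v.
Proof. by apply: assignment_eq => s x; rewrite /transport -ktrans_comp. Qed.

Lemma transport_extend V p q (pq : (p <= q)%O) (v : assignment V (K p)) s
    (a : K p s) :
  transport pq (extend v a) = extend (transport pq v) (ktrans pq a).
Proof. by apply: assignment_eq => s' [|s0 x]. Qed.

Lemma ktrans_teval V p q (pq : (p <= q)%O) (v : assignment V (K p)) s
    (t : term V s) :
  ktrans pq (teval v t) = teval (transport pq v) t.
Proof.
elim: t => [//|f ts IH] /=; rewrite ktrans_fun_int; congr fun_int.
exact: functional_extensionality_dep.
Qed.

(** Needed for [entails_curry] and, since [All] looks at later nodes, for
[entails_All_intro].  The terms of an atom under a quantifier contain
nameless variables, which is why [ktrans_rel_int] and [ktrans_teval] speak of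
arbitrary elements and variables. *)
Lemma valid_persist V (A : form V) p q (pq : (p <= q)%O)
    (v : assignment V (K p)) :
  valid_at A v -> valid_at A (transport pq v).
Proof.
elim: A p q pq v => {V} //=
  [V r ts|V A IA B IB|V A IA B IB|V A IA B IB|V s A IA|V s A IA] p q pq v.
- move=> /(ktrans_rel_int pq).
  suff -> : (fun i => ktrans pq (teval v (ts i))) =
            (fun i => teval (transport pq v) (ts i)) by [].
  by apply: functional_extensionality_dep => i; exact: ktrans_teval.
- by move=> [/IA HA /IB HB]; split; [exact: HA|exact: HB].
- by move=> [/IA HA|/IB HB]; [left; exact: HA|right; exact: HB].
- move=> H r qr; have := H r (Order.POrderTheory.le_trans pq qr).
  by rewrite -/(transport _ v) -/(transport qr _) (transport_comp _ _
    (Order.POrderTheory.le_trans pq qr)).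
- move=> H r qr a; have := H r (Order.POrderTheory.le_trans pq qr) a.
  by rewrite -/(transport _ v) -/(transport qr _) (transport_comp _ _
    (Order.POrderTheory.le_trans pq qr)).
- move=> [a /(IA _ _ pq)]; rewrite transport_extend => H.
  by exists (ktrans pq a).
Qed.

Lemma valid_FV V (A : form V) p (v w : assignment V (K p)) :
  (forall s x, FV A (existT _ s x) -> v s x = w s x) ->
  valid_at A v -> valid_at A w.
Proof.
elim: A p v w => {V} //=
  [V r ts|V A IA B IB|V A IA B IB|V A IA B IB|V s A IA|V s A IA] p v w vw.
- suff -> : (fun i => teval v (ts i)) = (fun i => teval w (ts i)) by [].
  apply: functional_extensionality_dep => i.
  by apply: teval_FV => s x xi; apply: vw; exists i.
- by move=> [HA HB]; split; [apply: IA HA|apply: IB HB] => s x xA; apply: vw;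
    [left|right].
- by move=> [HA|HB]; [left; apply: IA HA|right; apply: IB HB] => s x xA;
    apply: vw; [left|right].
- move=> H q pq; case: (H q pq) => [HA|HB]; [left => wA; apply: HA|right].
    by apply: IA wA => s x xA; rewrite vw //; left.
  by apply: IB HB => s x xB; rewrite vw //; right.
- move=> H q pq a; apply: IA (H q pq a) => s' [//|s0 x] xA /=.
  by rewrite vw.
- move=> [a H]; exists a; apply: IA H => s' [//|s0 x] xA /=.
  by rewrite vw.
Qed.

Lemma teval_lift_bind V W (sigma : forall s, V s -> term W s) p
    (v : assignment W (K p)) s (a : K p s) :
  (fun _ y => teval (extend v a) (lift_bind sigma (s := s) y)) =
  extend (fun _ x => teval v (sigma _ x)) a.
Proof. by apply: assignment_eq => s' [//|s0 x] /=; rewrite teval_tbind. Qed.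

Lemma transport_teval V W (sigma : forall s, V s -> term W s) p q
    (pq : (p <= q)%O) (v : assignment W (K p)) :
  transport pq (fun _ x => teval v (sigma _ x)) =
  (fun _ x => teval (transport pq v) (sigma _ x)).
Proof. by apply: assignment_eq => s x; exact: ktrans_teval. Qed.

Lemma valid_fbind V W (sigma : forall s, V s -> term W s) (A : form V) p
    (v : assignment W (K p)) :
  valid_at (fbind sigma A) v <-> valid_at A (fun _ x => teval v (sigma _ x)).
Proof.
elim: A W sigma p v => {V} //=
  [V r ts|V A IA B IB|V A IA B IB|V A IA B IB|V s A IA|V s A IA] W sigma p v.
- suff -> : (fun i => teval v (tbind sigma (ts i))) =
     (fun i => teval (fun _ x => teval v (sigma _ x)) (ts i)) by [].
  by apply: functional_extensionality_dep => i; exact: teval_tbind.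
- by rewrite IA IB.
- by rewrite IA IB.
- have E q (pq : (p <= q)%O) := transport_teval sigma pq v.
  by split=> H q pq; move: (H q pq); rewrite IA IB;
    rewrite -[fun _ x => ktrans pq (teval _ _)]/(transport pq _) E.
- have E q (pq : (p <= q)%O) := transport_teval sigma pq v.
  by split=> H q pq a; move: (H q pq a); rewrite IA teval_lift_bind;
    rewrite -[fun _ x => ktrans pq (teval _ _)]/(transport pq _) E.
- by split=> -[a H]; exists a; move: H; rewrite IA teval_lift_bind.
Qed.

(** * Substitution and quantification over a named variable *)

Lemma valid_subst s (x : vset s) (t : lterm s) (A : ltype Sigma) p
    (v : assignment (@vset Sigma) (K p)) :
  valid_at (subst x t A) v <-> valid_at A (update x (teval v t) v).
Proof.
rewrite valid_fbind; set w := (X in valid_at A X).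
suff -> : w = update x (teval v t) v by [].
apply: assignment_eq => s' y.
exact: (update_map (fun _ u => teval v u)).
Qed.

Lemma valid_bind_var s (x : vset s) (A : ltype Sigma) p
    (v : assignment (@vset Sigma) (K p)) (a : K p s) :
  valid_at (bind_var x A) (extend v a) <-> valid_at A (update x a v).
Proof.
rewrite valid_fbind; set w := (X in valid_at A X).
suff -> : w = update x a v by [].
apply: assignment_eq => s' y.
exact: (update_map (fun _ u => teval (extend v a) u)).
Qed.

Lemma valid_All s (x : vset s) (A : ltype Sigma) p
    (v : assignment (@vset Sigma) (K p)) :
  valid_at (All x A) v <->
  forall q (pq : (p <= q)%O) (a : K q s),
    valid_at A (update x a (transport pq v)).
Proof. by split=> H q pq a; apply/valid_bind_var; exact: H. Qed.

Lemma valid_Ex s (x : vset s) (A : ltype Sigma) p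
    (v : assignment (@vset Sigma) (K p)) :
  valid_at (Ex x A) v <-> exists a : K p s, valid_at A (update x a v).
Proof. by split=> -[a H]; exists a; apply/valid_bind_var. Qed.

Lemma valid_update_fresh s (x : vset s) (B : ltype Sigma) p
    (v : assignment (@vset Sigma) (K p)) (a : K p s) :
  fresh x B -> valid_at B (update x a v) <-> valid_at B v.
Proof.
move=> xB; have E s' y : FV B (existT _ s' y) -> update x a v y = v s' y.
  by move=> yB; apply: update_neq => yx; apply: xB; rewrite -yx.
by split; apply: valid_FV => s' y /E.
Qed.

(** * Entailment *)

Definition entails (A B : ltype Sigma) : Prop :=
  forall p (v : assignment (@vset Sigma) (K p)), valid_at A v -> valid_at B v.

Lemma entails_curry (C A B : ltype Sigma) :
  entails (And C A) B -> entails C (Imp A B).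
Proof.
move=> CAB p v HC q pq; case: (pselect (valid_at A (transport pq v))) => HA.
  by right; apply: CAB; split=> //; exact: valid_persist.
by left.
Qed.

Lemma entails_ev (A B : ltype Sigma) : entails (And (Imp A B) A) B.
Proof.
move=> p v [H HA]; have := H p (Order.POrderTheory.lexx p).
by rewrite -/(transport _ v) transport_id => -[].
Qed.

(** Gives the inverse of [Delta]. *)
Lemma entails_distr (A B C : ltype Sigma) :
  entails (And A (Or B C)) (Or (And A B) (And A C)).
Proof. by move=> p v [HA [HB|HC]]; [left|right]. Qed.

Lemma subst_self s (x : vset s) (A : ltype Sigma) : subst x (TVar x) A = A.
Proof.
by apply: fbind_id => s' y _; exact: (update_id x (fun _ z => TVar z)).
Qed.

Lemma entails_All_elim s (x : vset s) (A : ltype Sigma) (t : lterm s) :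
  entails (All x A) (subst x t A).
Proof.
move=> p v /valid_All /(_ p (Order.POrderTheory.lexx p) (teval v t)).
by rewrite transport_id => /valid_subst.
Qed.

(** The instance of [A] at the term [x] suffices: it is [A] itself, and every
element is the value of [x] under some assignment. *)
Lemma entails_All_intro s (x : vset s) (A B : ltype Sigma) :
  fresh x B -> (forall t, entails B (subst x t A)) -> entails B (All x A).
Proof.
move=> xB /(_ (TVar x)); rewrite subst_self => BA p v HB.
apply/valid_All => q pq a; apply: BA; apply/valid_update_fresh => //.
exact: valid_persist.
Qed.

Lemma entails_Ex_intro s (x : vset s) (A : ltype Sigma) (t : lterm s) :
  entails (subst x t A) (Ex x A).
Proof. by move=> p v /valid_subst H; apply/valid_Ex; exists (teval v t). Qed.

Lemma entails_Ex_elim s (x : vset s) (A B : ltype Sigma) :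
  fresh x B -> (forall t, entails (subst x t A) B) -> entails (Ex x A) B.
Proof.
move=> xB /(_ (TVar x)); rewrite subst_self => AB p v /valid_Ex [a /AB].
by move/(valid_update_fresh _ _ xB).
Qed.

Lemma entails_frobenius s (x : vset s) (A B : ltype Sigma) :
  fresh x A -> entails (And A (Ex x B)) (Ex x (And A B)).
Proof.
move=> xA p v [HA /valid_Ex [a HB]]; apply/valid_Ex; exists a.
by split=> //; apply/valid_update_fresh.
Qed.

(** * The category of entailment *)

(** A subset type over the full set, because the objects of a member of
[sigma_str] form a subset of the formulae. *)
Definition entob := {A : ltype Sigma | [set: ltype Sigma]%classic A}.

Definition toob (A : ltype Sigma) : entob := exist _ A I.

Lemma toob_surj (X : entob) : exists A, toob A = X.
Proof. by exists (sval X); apply: sig_eq. Qed.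

Definition entcat : category entob :=
  @Category entob (fun X Y => entails (sval X) (sval Y))
    (fun _ _ _ H => H)
    (fun _ _ _ g f p v H => g p v (f p v H))
    (fun _ _ _ => erefl) (fun _ _ _ => erefl) (fun _ _ _ _ _ _ _ => erefl).

Lemma entcat_thin (X Y : entob) (f g : hom entcat X Y) : f = g.
Proof. exact: (@Prop_irrelevance (entails (sval X) (sval Y)) f g). Qed.

Definition entbcc : bicartesian_closed entcat.
Proof.
unshelve refine (@BicartesianClosed entob entcat
  (toob Top) _
  (fun X Y => toob (And (sval X) (sval Y)))
  (fun _ _ p v H => proj1 H) (fun _ _ p v H => proj2 H)
  (fun _ _ _ f g p v H => conj (f p v H) (g p v H)) _ _ _
  (toob Bot) _
  (fun X Y => toob (Or (sval X) (sval Y)))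
  (fun _ _ p v H => or_introl H) (fun _ _ p v H => or_intror H)
  (fun _ _ _ f g p v H => or_ind (f p v) (g p v) H) _ _ _
  (fun Y X => toob (Imp (sval X) (sval Y)))
  (fun X Y => @entails_ev _ _)
  (fun _ _ _ => @entails_curry _ _ _) _ _);
  try by move=> *; exact: entcat_thin.
- by move=> X; exists (fun _ _ _ => Logic.I) => g; exact: entcat_thin.
- by move=> X; exists (fun _ _ => False_ind _) => g; exact: entcat_thin.
Defined.

Section Quantifiers.
Context (s : sorts Sigma) (x : vset s) (A : ltype Sigma).

(** The vertex of an object is [B] for some formula [B] without [x], which is
what the introduction rule of [All] asks for; uniqueness is thinness. *)
Lemma All_terminal : exists T,
  cone_vertex (proj1_sig T) = toob (All x A) /\
  terminal (K_All entcat toob x A) T.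
Proof.
pose c := @Cone entob entcat (lterm s) (subst_diagram toob x A)
  (toob (All x A)) (fun t => @entails_All_elim s x A t).
have cP : K_All_ob c by exists (All x A); split => //; exact: fresh_All.
exists (exist _ c cP); split=> // -[d dP].
have dc : entails (sval (cone_vertex d)) (All x A).
  case: (dP) => B [xB dB]; move: (cone_leg d); rewrite dB => l.
  exact: entails_All_intro.
have dcP t : compm (cone_leg c t) dc = cone_leg d t by exact: entcat_thin.
exists (exist _ (exist _ dc dcP) (or_intror erefl)) => g.
by do 2!apply: sig_eq; exact: entcat_thin.
Qed.

Lemma Ex_initial : exists I,
  cocone_vertex (proj1_sig I) = toob (Ex x A) /\
  initial (K_Ex entcat toob x A) I.
Proof.
pose c := @Cocone entob entcat (lterm s) (subst_diagram toob x A)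
  (toob (Ex x A)) (fun t => @entails_Ex_intro s x A t).
have cP : K_Ex_ob c by exists (Ex x A); split => //; exact: fresh_Ex.
exists (exist _ c cP); split=> // -[d dP].
have cd : entails (Ex x A) (sval (cocone_vertex d)).
  case: (dP) => B [xB dB]; move: (cocone_leg d); rewrite dB => l.
  exact: entails_Ex_elim.
have cdP t :
    @compm _ entcat _ (toob (Ex x A)) (cocone_vertex d) cd (cocone_leg c t) =
    cocone_leg d t by exact: entcat_thin.
exists (exist _ (exist _ cd cdP) (or_intror erefl)) => g.
by do 2!apply: sig_eq; exact: entcat_thin.
Qed.

End Quantifiers.

Lemma entcat_inverse (X Y : entob) (f : hom entcat X Y) :
  hom entcat Y X -> has_inverse f.
Proof. by move=> g; exists g; split; exact: entcat_thin. Qed.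

Definition entld : logically_distributive entcat toob.
Proof.
unshelve refine (@LogicallyDistributive Sigma entob entcat toob entbcc
  _ _ _ erefl erefl (fun _ _ => erefl) (fun _ _ => erefl) (fun _ _ => erefl)
  All_terminal Ex_initial _).
- by move=> X Y Z; apply: entcat_inverse; exact: entails_distr.
- by move=> s x A; have [T [_ HT]] := All_terminal x A; exists T.
- by move=> s x A; have [I [_ HI]] := Ex_initial x A; exists I.
- move=> s x A B xA I J IE JE _ _ f; apply: entcat_inverse.
  (* The inverse goes from [And A (Ex x B)] to [Ex x (And A B)] once the
     vertexes are replaced by their values [IE] and [JE]. *)
  rewrite IE /= JE; exact: entails_frobenius.
Defined.

Definition entstr : sigma_str Sigma := SigmaStr entld toob_surj.

End Kripke.

Theorem proposition11p3 (disp : Order.disp_t) (P : porderType disp)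
    (Sigma : signature) (K : kripke_model P Sigma) :
  exists D : sigma_str Sigma,
    forall phi : ltype Sigma, kripke_valid K phi <-> str_valid D phi.
Proof.
exists (entstr K) => phi; split=> [H|[H] p v]; last exact: H.
by constructor=> p v _; exact: H.
Qed.
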